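(* Let $\mathcal{M}$ be a 4-orbit map whose truncation $\mathrm{Tr}(\mathcal{M})$ is a 4-orbit map. Then exactly one of the following holds. (i) $\mathcal{M}$ and $\mathrm{Tr}(\mathcal{M})$ are both of type $4_{D_p}$; (ii) $\mathcal{M}$ is of type $4_E$ and $\mathrm{Tr}(\mathcal{M})$ is of type $4_D$; (iii) $\mathcal{M}$ is of type $4_G$ and $\mathrm{Tr}(\mathcal{M})$ is of type $4_{G_d}$.
   Context: A map $\mathcal{M}$ is a 2-cell embedding of a connected graph on a surface. Its flags are the triangles of the barycentric subdivision of $\mathcal{M}$, each identified with a triple $(\Phi_0,\Phi_1,\Phi_2)$ of a mutually incident vertex, edge and face; $\mathcal{F}(\mathcal{M})$ is the set of flags. For $i\in\{0,1,2\}$ let $s_i$ be the permutation of $\mathcal{F}(\mathcal{M})$ (acting on the right) sending each flag $\Phi$ to its $i$-adjacent flag $\Phi^{s_i}=\Phi^i$ (the neighbouring triangle differing from $\Phi$ only in the entry $\Phi_i$). The $s_i$ are fixed-point free involutions, $s_0s_2=s_2s_0$ is a fixed-point free involution, and $\langle s_0,s_1,s_2\rangle$ is transitive on $\mathcal{F}(\mathcal{M})$. The automorphism group $\Gamma(\mathcal{M})$ is (identified with) the group of permutations of $\mathcal{F}(\mathcal{M})$ commuting with $s_0,s_1,s_2$; it acts freely on flags. $\mathcal{M}$ is a $k$-orbit map if $\Gamma(\mathcal{M})$ has exactly $k$ orbits on $\mathcal{F}(\mathcal{M})$. The $s_i$ act on the set $\mathrm{Orb}(\mathcal{M})$ of flag-orbits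 by $\mathcal{O}_\Phi\cdot s_i=\mathcal{O}_{\Phi^{s_i}}$. Symmetry type graph: $T(\mathcal{M})$ has vertex set $\mathrm{Orb}(\mathcal{M})$, with an edge of colour $i$ joining two distinct orbits interchanged by $s_i$, and a semi-edge of colour $i$ at each orbit fixed by $s_i$. A type with $k$ vertices is given below by a triple $(\sigma_0,\sigma_1,\sigma_2)$ of permutations of $\{1,\dots,k\}$ in cycle notation: $\mathcal{M}$ is of that type iff there is a bijection $\mathrm{Orb}(\mathcal{M})\to\{1,\dots,k\}$ carrying the action of $s_i$ to $\sigma_i$ for $i=0,1,2$. (For $\mathrm{Tr}(\mathcal{M})$, the involutions $r_i$ below play the role of $s_i$.) Truncation: $\mathrm{Tr}(\mathcal{M})$ is the map on the same surface with flag set $\mathcal{F}(\mathcal{M})\times\{0,1,2\}$ and flag adjacencies $r_0,r_1,r_2$ given by $(\Phi,0)r_0=(\Phi^{s_1},0)$, $(\Phi,0)r_1=(\Phi^{s_2},0)$, $(\Phi,0)r_2=(\Phi,2)$; $(\Phi,1)r_0=(\Phi^{s_0},1)$, $(\Phi,1)r_1=(\Phi,2)$, $(\Phi,1)r_2=(\Phi^{s_2},1)$; $(\Phi,2)r_0=(\Phi^{s_1},2)$, $(\Phi,2)r_1=(\Phi,1)$, $(\Phi,2)r_2=(\Phi,0)$. Types on $\{1,2,3,4\}$: $4_{D_p}$: $\sigma_0=(3\,4)$, $\sigma_1=(2\,3)$, $\sigma_2=(1\,2)$. $4_D$: $\sigma_0=(1\,2)(3\,4)$, $\sigma_1=(2\,3)$,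 $\sigma_2=(1\,2)$. $4_E$: $\sigma_0=(1\,4)(2\,3)$, $\sigma_1=(1\,2)(3\,4)$, $\sigma_2=(2\,3)$. $4_G$: $\sigma_0=\sigma_1=(1\,4)(2\,3)$, $\sigma_2=(1\,2)(3\,4)$. $4_{G_d}$: $\sigma_0=(1\,4)(2\,3)$, $\sigma_1=\sigma_2=(1\,2)(3\,4)$. *)

(* Defs.v *)
From mathcomp Require Import all_boot all_fingroup.
From mathcomp Require Import boolp classical_sets functions cardinality.

Set Implicit Arguments.
Unset Strict Implicit.
Unset Printing Implicit Defensive.

Local Open Scope classical_set_scope.

Definition i0 : 'I_3 := @Ordinal 3 0 isT.
Definition i1 : 'I_3 := @Ordinal 3 1 isT.
Definition i2 : 'I_3 := @Ordinal 3 2 isT.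

(* A map on a surface, given by its flags and flag adjacencies; [adj i x] is
   the i-adjacent flag x^{s_i}. The flag set may be infinite. As the adjacencies
   are involutions, transitivity of the group they generate is stated with
   words in them. *)
Record surface_map := SurfaceMap {
  flag : Type;
  adj : 'I_3 -> flag -> flag;
  flag_inhabited : inhabited flag;
  adjK : forall i, involutive (adj i);
  adj_fpf : forall i x, adj i x <> x;
  adj02C : forall x, adj i2 (adj i0 x) = adj i0 (adj i2 x);
  adj02_fpf : forall x, adj i2 (adj i0 x) <> x;
  adj_trans : forall x y, exists w : seq 'I_3,
    y = foldl (fun z i => adj i z) x w }.

Definition automorphism (M : surface_map) : set (flag M -> flag M) :=
  [set phi | bijective phi /\ forall i x, phi (adj i x) = adj i (phi x)].
Arguments automorphism : clear implicits.

Definition flag_orbit (M : surface_map) (x : flag M) : set (flag M) :=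
  [set phi x | phi in automorphism M].

Definition Orb (M : surface_map) : set (set (flag M)) := range (@flag_orbit M).
Arguments Orb : clear implicits.

Definition k_orbit_map (k : nat) (M : surface_map) : Prop :=
  (Orb M #= `I_k)%card.

(* [sigma i] is the permutation sigma_i; vertices are numbered from 0. *)
Definition symmetry_type (k : nat) := 'I_3 -> 'S_k.

Definition of_type (k : nat) (sigma : symmetry_type k) (M : surface_map) :=
  exists f : set (flag M) -> 'I_k,
    set_bij (Orb M) setT f /\
    forall i x, f (flag_orbit (adj i x)) = sigma i (f (flag_orbit x)).

(* The truncation cuts the flag x into three: (x, 0) lies in the new face
   replacing the vertex of x; (x, 1) and (x, 2) lie in the truncated face of x,
   along what remains of the edge of x and along the new face respectively. *)
Definition tr_adj (M : surface_map) (i : 'I_3) (p : flag M * 'I_3) :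
    flag M * 'I_3 :=
  let: (x, a) := p in
  match val a, val i with
  | 0, 0 => (adj i1 x, i0)
  | 0, 1 => (adj i2 x, i0)
  | 0, _ => (x, i2)
  | 1, 0 => (adj i0 x, i1)
  | 1, 1 => (x, i2)
  | 1, _ => (adj i2 x, i1)
  | _, 0 => (adj i1 x, i2)
  | _, 1 => (x, i1)
  | _, _ => (x, i0)
  end.

Lemma ord3P (P : 'I_3 -> Prop) : P i0 -> P i1 -> P i2 -> forall i, P i.
Proof.
move=> P0 P1 P2 [[|[|[|//]]] Hi].
- by rewrite (_ : Ordinal Hi = i0) //; apply: val_inj.
- by rewrite (_ : Ordinal Hi = i1) //; apply: val_inj.
- by rewrite (_ : Ordinal Hi = i2) //; apply: val_inj.
Qed.

Section Truncation.
Variable M : surface_map.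

Lemma tr_inhabited : inhabited (flag M * 'I_3).
Proof. by case: (flag_inhabited M) => x; exists; exact: (x, i0). Qed.

Lemma tr_adjK i : involutive (@tr_adj M i).
Proof.
by move=> [x a]; elim/ord3P: a; elim/ord3P: i; rewrite /tr_adj /= ?adjK.
Qed.

Lemma tr_adj_fpf i p : @tr_adj M i p <> p.
Proof.
by case: p => x a; elim/ord3P: a; elim/ord3P: i; rewrite /tr_adj //= => -[];
  apply: adj_fpf.
Qed.

Lemma tr_adj02C p :
  @tr_adj M i2 (@tr_adj M i0 p) = @tr_adj M i0 (@tr_adj M i2 p).
Proof. by case: p => x a; elim/ord3P: a; rewrite /tr_adj //= adj02C. Qed.

Lemma tr_adj02_fpf p : @tr_adj M i2 (@tr_adj M i0 p) <> p.
Proof.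
by case: p => x a; elim/ord3P: a; rewrite /tr_adj //= => -[]; apply: adj02_fpf.
Qed.

Lemma tr_adj_trans p q : exists w : seq 'I_3,
  q = foldl (fun z i => @tr_adj M i z) p w.
Proof.
pose act := foldl (fun z i => @tr_adj M i z).
have step (u v t : flag M * 'I_3) :
    (exists w, v = act u w) -> (exists w, t = act v w) -> exists w, t = act u w.
  by move=> [w1 ->] [w2 ->]; exists (w1 ++ w2); rewrite /act foldl_cat.
have to0 x a : exists w, (x, i0) = act (x, a) w.
  elim/ord3P: a; first by exists [::].
    by exists [:: i1; i2].
  by exists [:: i2].
have from0 x a : exists w, (x, a) = act (x, i0) w.
  elim/ord3P: a; first by exists [::].
    by exists [:: i2; i1].
  by exists [:: i2].
have gen x i : exists w, (adj i x, i0) = act (x, i0) w.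
  elim/ord3P: i; first by exists [:: i2; i1; i0; i1; i2].
    by exists [:: i0].
  by exists [:: i1].
case: p q => [x a] [y b].
apply: (step _ _ _ (to0 x a)); apply: (step _ _ _ _ (from0 y b)).
have [w ->] := adj_trans x y.
elim: w x => [|i w IH] x; first by exists [::].
exact: (step _ _ _ (gen x i) (IH _)).
Qed.

Definition truncation : surface_map :=
  SurfaceMap tr_inhabited tr_adjK tr_adj_fpf tr_adj02C tr_adj02_fpf
    tr_adj_trans.

End Truncation.

(* The vertices 1, 2, 3, 4 of the four-vertex types. *)
Definition v1 : 'I_4 := @Ordinal 4 0 isT.
Definition v2 : 'I_4 := @Ordinal 4 1 isT.
Definition v3 : 'I_4 := @Ordinal 4 2 isT.
Definition v4 : 'I_4 := @Ordinal 4 3 isT.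

Definition mk_type (a b c : 'S_4) : symmetry_type 4 := tnth [tuple a; b; c].

Definition type_4Dp : symmetry_type 4 :=
  mk_type (tperm v3 v4) (tperm v2 v3) (tperm v1 v2).

Definition type_4D : symmetry_type 4 :=
  mk_type (tperm v1 v2 * tperm v3 v4)%g (tperm v2 v3) (tperm v1 v2).

Definition type_4E : symmetry_type 4 :=
  mk_type (tperm v1 v4 * tperm v2 v3)%g (tperm v1 v2 * tperm v3 v4)%g
    (tperm v2 v3).

Definition type_4G : symmetry_type 4 :=
  mk_type (tperm v1 v4 * tperm v2 v3)%g (tperm v1 v4 * tperm v2 v3)%g
    (tperm v1 v2 * tperm v3 v4)%g.

Definition type_4Gd : symmetry_type 4 :=
  mk_type (tperm v1 v4 * tperm v2 v3)%g (tperm v1 v2 * tperm v3 v4)%g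
    (tperm v1 v2 * tperm v3 v4)%g.

Definition exactly_one (P Q R : Prop) : Prop :=
  [\/ [/\ P, ~ Q & ~ R], [/\ ~ P, Q & ~ R] | [/\ ~ P, ~ Q & R]].

(* Main.v *)
From mathcomp Require Import all_boot all_fingroup.
From mathcomp Require Import boolp classical_sets functions cardinality.
Require Import Defs.

(** Every automorphism of the map [M] acts on the truncation, so [M] and its
    truncation having four flag orbits each says that the truncation is three
    times as symmetric as [M]. An automorphism of the truncation that sends a
    vertex-face flag [(x, 0)] to a vertex-face flag [(y, 0)] comes from an
    automorphism of [M] ([flag_orbit_truncation]). Hence [x |-> (x, 0)] embeds
    the four orbits of [M] in the four orbits of the truncation, and this
    embedding is a bijection: both symmetry types live on the same four points.

    Let [a], [b], [c] be the permutations of these points by which [r_0], [r_1],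
    [r_2] act. Then [s_1] acts as [a] and [s_2] acts as [b], since this is how
    [r_0] and [r_1] act on vertex-face flags. The path [r_2 r_1 r_0 r_1 r_2]
    leads from [(x, 0)] to [(x^{s_0}, 0)], so [s_0] acts as [c b a b c]. As the
    truncation is cubic, [b c b = c b c]; moreover [a] commutes with [c], and
    the three permutations are transitive. Only three such triples exist up to
    renumbering ([braid_types]), and each of them determines both types. The
    three outcomes exclude one another because, for any two of the resulting
    types of [M], some colour has semi-edges in exactly one of them
    ([of_type_semi_edge]). *)

Set Implicit Arguments.
Unset Strict Implicit.
Unset Printing Implicit Defensive.

Local Open Scope classical_set_scope.

(** * Flag orbits *)

Lemma flag_orbitP (M : surface_map) (x y : flag M) :
  flag_orbit x = flag_orbit y <-> exists2 phi, automorphism M phi & phi x = y.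
Proof.
split=> [eq_xy | [phi [phi_bij phiC] <-]].
  suff [phi phi_aut phi_x] : flag_orbit x y by exists phi.
  by rewrite eq_xy; exists id => //; split=> //; exists id.
have [psi phiK psiK] := phi_bij.
have psiC i z : psi (adj i z) = adj i (psi z).
  by rewrite -{1}(psiK z) -phiC phiK.
apply/seteqP; split=> z [th [th_bij thC] <-].
  exists (th \o psi) => /=; last by rewrite phiK.
  split=> [|i t /=]; last by rewrite psiC thC.
  by apply: bij_comp => //; exists phi.
exists (th \o phi) => //=; split=> [|i t /=]; last by rewrite phiC thC.
exact: bij_comp.
Qed.

Lemma flag_orbit_adj (M : surface_map) (i : 'I_3) (x y : flag M) :
  flag_orbit x = flag_orbit y -> flag_orbit (adj i x) = flag_orbit (adj i y).
Proof.
move=> /flag_orbitP[phi phi_aut <-]; apply/flag_orbitP; exists phi => //.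
by case: phi_aut => _ ->.
Qed.

(** A flag of the truncation that lies on a vertex face remembers the flag of
    the original map it was cut from, and the adjacencies of the original map
    are words in those of the truncation that do not depend on the flag (see
    [gen]). Hence an automorphism of the truncation that sends one vertex-face
    flag to another acts on all flags as an automorphism of the original map
    does. *)
Lemma flag_orbit_truncation (M : surface_map) (x y : flag M) :
  flag_orbit (M := truncation M) (x, i0) =
    flag_orbit (M := truncation M) (y, i0) <-> flag_orbit x = flag_orbit y.
Proof.
split=> /flag_orbitP[phi phi_aut phi_x]; apply/flag_orbitP; last first.
  case: phi_aut => [[psi phiK psiK] phiC].
  exists (fun p => (phi p.1, p.2)); last by rewrite /= phi_x.
  split=> [|i [z a]].
    by exists (fun p => (psi p.1, p.2)) => -[z a] /=; rewrite ?phiK ?psiK.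
  by elim/ord3P: a; elim/ord3P: i; rewrite /= /tr_adj /= ?phiC.
(* Stated for any intertwiner, so that it applies to the inverse as well. *)
have walk (psi : flag (truncation M) -> flag (truncation M)) (u v : flag M) :
    (forall i p, psi (adj i p) = adj i (psi p)) ->
    psi (u, i0) = (v, i0) ->
  forall z, exists2 t, psi (z, i0) = (t, i0) &
    forall i, psi (adj i z, i0) = (adj i t, i0).
  move=> psiC psi_u z; pose r := @adj (truncation M).
  have gen i s t : psi (s, i0) = (t, i0) -> psi (adj i s, i0) = (adj i t, i0).
    move=> psi_s; elim/ord3P: i.
    - have := psiC i2 (r i1 (r i0 (r i1 (r i2 (s, i0))))).
      by rewrite /r !psiC psi_s.
    - by have := psiC i0 (s, i0); rewrite psi_s.
    - by have := psiC i1 (s, i0); rewrite psi_s.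
  suff [t psi_z] : exists t, psi (z, i0) = (t, i0).
    by exists t => // i; apply: gen.
  have [w ->] := adj_trans u z; elim: w u v psi_u => [|i w IH] u v psi_u /=.
    by exists v.
  by apply: (IH (adj i u) (adj i v)); apply: gen.
case: phi_aut => [[psi phiK psiK] phiC].
have psiC i p : psi (adj i p) = adj i (psi p).
  by rewrite -{1}(psiK p) -phiC phiK.
have psi_y : psi (y, i0) = (x, i0) by rewrite -phi_x phiK.
exists (fun z => (phi (z, i0)).1); last by rewrite phi_x.
split=> [|i z]; last first.
  by have [t -> ->] := walk _ _ _ phiC phi_x z.
exists (fun z => (psi (z, i0)).1) => z.
  by have [t phi_z _] := walk _ _ _ phiC phi_x z; rewrite phi_z -phi_z phiK.
by have [t psi_z _] := walk _ _ _ psiC psi_y z; rewrite psi_z -psi_z psiK.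
Qed.

(** * Labellings of the flag orbits *)

(** [f] numbers the flag orbits of [M], and is viewed as a function of flags so
    that labels can be computed along adjacencies. *)
Definition orbit_labelling (M : surface_map) (k : nat) (f : flag M -> 'I_k) :=
  (forall v, exists x, f x = v) /\
  (forall x y, f x = f y <-> flag_orbit x = flag_orbit y).

Lemma orbit_labelling_exists (M : surface_map) (k : nat) :
  k_orbit_map k.+1 M -> exists f : flag M -> 'I_k.+1, orbit_labelling f.
Proof.
move=> /card_set_bijP[f [f_fun f_inj f_surj]].
have f_lt x : f (flag_orbit x) < k.+1 by apply: f_fun; exists x.
exists (fun x => Ordinal (f_lt x)); split=> [v|x y].
  have [_ [x _ <-] fx] := f_surj v (ltn_ord v).
  by exists x; apply: val_inj.
split=> [[]|eq_xy]; last by apply: val_inj; rewrite /= eq_xy.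
by apply: f_inj; rewrite inE; [exists x | exists y].
Qed.

(** By counting: a numbering that separates the [k.+1] orbits uses every label.
    This replaces the comparison of indices of automorphism groups, which may be
    infinite. *)
Lemma orbit_labelling_onto (M : surface_map) (k : nat) (f : flag M -> 'I_k.+1) :
    k_orbit_map k.+1 M ->
    (forall x y, f x = f y <-> flag_orbit x = flag_orbit y) ->
  orbit_labelling f.
Proof.
move=> /orbit_labelling_exists[g [g_surj gP]] fP; split=> // v.
have [rep repP] := choice g_surj.
have f_inj : injective (f \o rep).
  by move=> s t /fP/gP; rewrite !repP.
by have /codomP[s ->] := injF_onto f_inj v; exists (rep s).
Qed.

Lemma orbit_action_exists (M : surface_map) (k : nat) (f : flag M -> 'I_k) :
    orbit_labelling f ->
  exists s : symmetry_type k, forall i x, f (adj i x) = s i (f x).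
Proof.
move=> [f_surj fP]; have [rep repP] := choice f_surj.
have act_inj i : injective (fun v => f (adj i (rep v))).
  move=> v w /fP/(flag_orbit_adj i); rewrite !adjK => /fP.
  by rewrite !repP.
exists (fun i => perm (@act_inj i)) => i x; rewrite permE.
by apply/fP/flag_orbit_adj/fP; rewrite repP.
Qed.

Definition type_iso (k : nat) (t s : symmetry_type k) :=
  exists2 u : 'I_k -> 'I_k, injective u & forall i v, s i (u v) = u (t i v).

Lemma of_type_labelling (M : surface_map) (k : nat) (f : flag M -> 'I_k)
    (s t : symmetry_type k) :
    orbit_labelling f -> (forall i x, f (adj i x) = s i (f x)) ->
  type_iso t s -> of_type t M.
Proof.
move=> [f_surj fP] fs [u u_inj us].
have [u' uK u'K] := injF_bij u_inj.
(* A default label for sets that are not flag orbits. *)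
have [x0] := flag_inhabited M.
have [F FP] : exists F : set (flag M) -> 'I_k,
    forall x, F (flag_orbit x) = u' (f x).
  have /choice[F FP] (A : set (flag M)) :
      exists v, forall x, A = flag_orbit x -> v = u' (f x).
    have [[x Ax]|noA] := pselect (exists x, A = flag_orbit x).
      by exists (u' (f x)) => y; rewrite Ax => /fP ->.
    by exists (f x0) => x Ax; case: noA; exists x.
  by exists F => x; apply: FP.
exists F; split=> [|i x]; last by rewrite !FP fs -{1}(u'K (f x)) us uK.
split=> //.
  move=> _ _ /set_mem[x _ <-] /set_mem[y _ <-]; rewrite !FP => /(can_inj u'K).
  by move/fP.
move=> v _; have [x fx] := f_surj (u v).
by exists (flag_orbit x); [exists x | rewrite FP fx uK].
Qed.

(** The number of semi-edges of each colour is an invariant of the map; whether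
    it vanishes is enough to tell apart the types at hand. *)
Lemma of_type_semi_edge (M : surface_map) (k : nat) (t : symmetry_type k)
    (i : 'I_3) :
    of_type t M ->
  (exists v, t i v = v) <->
  (exists x : flag M, flag_orbit (adj i x) = flag_orbit x).
Proof.
move=> [f [[_ f_inj f_surj] ft]]; split=> [[v tv]|[x eq_x]].
  have [_ [x _ <-] fx] := f_surj v Logic.I; exists x.
  by apply: f_inj; rewrite ?inE; [eexists| eexists |rewrite ft fx].
by exists (f (flag_orbit x)); rewrite -ft eq_x.
Qed.

Lemma of_type_neq (M : surface_map) (k : nat) (i : 'I_3)
    (s t : symmetry_type k) :
    (exists v, s i v = v) -> ~ (exists v, t i v = v) ->
  of_type s M -> ~ of_type t M.
Proof.
move=> si ti /(of_type_semi_edge i)[sM _] /(of_type_semi_edge i)[_ tM].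
by apply/ti/tM/sM.
Qed.

(** * Four-vertex types with a braid relation *)

Lemma ord4P (P : 'I_4 -> Prop) : P v1 -> P v2 -> P v3 -> P v4 -> forall v, P v.
Proof.
move=> P1 P2 P3 P4 [[|[|[|[|//]]]] Hv].
- by rewrite (_ : Ordinal Hv = v1) //; apply: val_inj.
- by rewrite (_ : Ordinal Hv = v2) //; apply: val_inj.
- by rewrite (_ : Ordinal Hv = v3) //; apply: val_inj.
- by rewrite (_ : Ordinal Hv = v4) //; apply: val_inj.
Qed.

Lemma uniq_ord_cover (n : nat) (s : seq 'I_n) :
  uniq s -> size s = n -> forall v, v \in s.
Proof.
move=> s_uniq s_size v.
have [||_ ->] := uniq_min_size (s2 := enum 'I_n) s_uniq.
- by move=> w _; rewrite mem_enum.
- by rewrite size_enum_ord s_size.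
- by rewrite mem_enum.
Qed.

Lemma type_iso4 (a b c : 'S_4) (s : symmetry_type 4) (u1 u2 u3 u4 : 'I_4)
    (u := tnth [tuple u1; u2; u3; u4])
    (iso_at := fun i (t : 'S_4) => [/\ s i u1 = u (t v1), s i u2 = u (t v2),
                                      s i u3 = u (t v3) & s i u4 = u (t v4)]) :
    uniq [:: u1; u2; u3; u4] -> iso_at i0 a -> iso_at i1 b -> iso_at i2 c ->
  type_iso (mk_type a b c) s.
Proof.
move=> u_uniq ua ub uc; exists u; first exact/tuple_uniqP.
by elim/ord3P; [case: ua | case: ub | case: uc] => ? ? ? ?; elim/ord4P.
Qed.

(** If [c] fixes every fixed point of [b], the braid relation gives the
    converse, so a point that [b] and [c] move differently is fixed by neither.
    For such a point [z], the points [z], [b z], [c z] are distinct, and both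
    [b (c z)] and [c (b z)] must be the fourth point, against the braid
    relation. *)
Lemma braid_fixed_point (b c : 'I_4 -> 'I_4) :
    involutive b -> involutive c ->
    (forall z, b (c (b z)) = c (b (c z))) ->
  b =1 c \/ exists2 z, b z = z & c z <> z.
Proof.
move=> bK cK braid.
have [?|no_z] := pselect (exists2 z, b z = z & c z <> z); first by right.
left; have fix_bc z : b z = z -> c z = z.
  by move=> bz; case: (eqVneq (c z) z) => // /eqP cz; case: no_z; exists z.
have fix_cb z : c z = z -> b z = z.
  move=> cz; have bcbz : b (c (b z)) = c (b z) by rewrite braid cz.
  have := fix_bc _ bcbz; rewrite cK => bz_cbz.
  by rewrite -{2}(bK z) bz_cbz bcbz.
move=> z; case: (eqVneq (b z) (c z)) => // /eqP bz_cz.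
have bz : b z != z by apply/eqP => bz; apply: bz_cz; rewrite bz fix_bc.
have cz : c z != z by apply/eqP => cz; apply: bz_cz; rewrite cz fix_cb.
have bcz : b (c z) != c z.
  by apply: contraNneq cz => /fix_bc; rewrite cK => <-.
have cbz : c (b z) != b z.
  by apply: contraNneq bz => /fix_cb; rewrite bK => <-.
have bcz_z : b (c z) != z.
  by apply/eqP => /(congr1 b); rewrite bK => E; case: bz_cz.
have cbz_z : c (b z) != z.
  by apply/eqP => /(congr1 c); rewrite cK => E; case: bz_cz.
have bcz_bz : b (c z) != b z by rewrite (inj_eq (can_inj bK)).
have cbz_cz : c (b z) != c z by rewrite (inj_eq (can_inj cK)).
have : c (b z) \in [:: z; b z; c z; b (c z)].
  apply: uniq_ord_cover => //=; rewrite !inE !negb_or.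
  move/eqP: bz_cz => bz_cz.
  rewrite ![z == _]eq_sym bz cz bcz_z bz_cz [b z == _]eq_sym bcz_bz.
  by rewrite eq_sym bcz.
rewrite !inE (negPf cbz_z) (negPf cbz) (negPf cbz_cz) /= => /eqP E.
by case: bz_cz; move: (braid z); rewrite E bK -E cK.
Qed.

(** Here [a], [b], [c] is a four-vertex type with a braid relation between its
    colours 1 and 2. The group generated by [b] and [c] is a quotient of the
    symmetric group on three letters: either [b = c], and [a], [b] generate a
    regular Klein four-group, or [b] and [c] are transpositions that share a
    point, say [(2 3)] and [(1 2)]. In the latter case [a] commutes with [c] and
    does not fix 4, so it is [(3 4)] or [(1 2)(3 4)]. *)
Lemma braid_types (a b c : 'I_4 -> 'I_4) :
    involutive a -> involutive b -> involutive c ->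
    (forall z, c (a z) = a (c z)) -> (forall z, b (c (b z)) = c (b (c z))) ->
    (forall P : pred 'I_4, (exists z, P z) ->
      (forall z, P z -> [/\ P (a z), P (b z) & P (c z)]) -> forall z, P z) ->
  (b =1 c /\ exists z, uniq [:: z; b z; a (b z); a z]) \/
  (exists u1 u2 u3 u4, [/\ uniq [:: u1; u2; u3; u4],
    [/\ b u1 = u1, b u2 = u3, b u3 = u2 & b u4 = u4],
    [/\ c u1 = u2, c u2 = u1, c u3 = u3 & c u4 = u4] &
    ([/\ a u1 = u1, a u2 = u2, a u3 = u4 & a u4 = u3] \/
     [/\ a u1 = u2, a u2 = u1, a u3 = u4 & a u4 = u3])]).
Proof.
move=> aK bK cK acC braid trans.
have [bc | [z bz cz]] := braid_fixed_point bK cK braid.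
  left; split=> //; exists v1.
  pose s := [:: v1; b v1; a (b v1); a v1].
  have abC z : b (a z) = a (b z) by rewrite !bc acC.
  have s_all : forall z, z \in s.
    apply: (trans (fun z => z \in s)); first by exists v1; rewrite inE eqxx.
    move=> z; rewrite -!(bc z) /s !inE => /or4P[] /eqP ->;
      by rewrite ?aK ?abC ?bK ?abC ?aK ?bK !eqxx ?orbT.
  have s_sub : {subset enum 'I_4 <= s} by move=> z _; apply: s_all.
  by apply: (leq_size_uniq (enum_uniq 'I_4) s_sub); rewrite size_enum_ord.
right; pose u := b (c z).
have cu : c u = u by rewrite /u -braid bz.
have bu : b u = c z by rewrite /u bK.
have u_cz : u != c z.
  by apply/eqP => E; apply: cz; apply: (can_inj cK); rewrite -E.
have z_u : z != u by apply/eqP => E; apply: cz; rewrite -bu -E.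
have z_cz : z != c z by rewrite eq_sym; apply/eqP.
have [w w_new] : exists w, w \notin [:: z; c z; u].
  apply/existsP; apply: contraT; rewrite negb_exists => /forallP all_s.
  have := uniq_leq_size (s2 := [:: z; c z; u]) (enum_uniq 'I_4).
  by rewrite size_enum_ord; apply=> v _; have := all_s v; rewrite negbK.
have uniq4 : uniq [:: z; c z; u; w].
  move: w_new; rewrite /= !inE !negb_or z_cz z_u [c z == u]eq_sym u_cz /=.
  by rewrite ![w == _]eq_sym => /and3P[-> -> ->].
have cover := uniq_ord_cover uniq4 erefl.
have fourth v : v != z -> v != c z -> v != u -> v = w.
  have := cover v.
  by rewrite !inE => /or4P[] /eqP ->; rewrite ?eqxx.
move: w_new; rewrite !inE !negb_or => /and3P[wz wcz wu].
have bw : b w = w by apply: fourth; rewrite (can2_eq bK bK) ?bz ?bu.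
have cw : c w = w by apply: fourth; rewrite (can2_eq cK cK) ?cK ?cu.
have c_fixed v : c v = v -> v = u \/ v = w.
  move=> cv; case: (eqVneq v u) => [|v_u]; [by left | right].
  apply: fourth => //; apply/eqP => v_z.
    by apply: cz; rewrite -v_z.
  by apply: cz; apply: (can_inj cK); rewrite -v_z cv.
have aw : a w = u.
  have [//|aw] : a w = u \/ a w = w by apply: c_fixed; rewrite acC cw.
  suff : z == w by rewrite eq_sym (negPf wz).
  apply: (trans (pred1 w)) => [|v /eqP ->]; first by exists w => /=.
  by rewrite /= aw bw cw eqxx.
have au : a u = w by rewrite -aw aK.
exists z, (c z), u, w; split=> //.
have az_u : a z != u by rewrite (can2_eq aK aK) au eq_sym.
have az_w : a z != w by rewrite (can2_eq aK aK) aw.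
have := cover (a z); rewrite !inE (negPf az_u) (negPf az_w) !orbF.
by case/orP => /eqP az; [left | right]; rewrite -acC az ?cK.
Qed.

Lemma types_4Dp_4E_4G_exclusive (M : surface_map) :
  [/\ of_type type_4Dp M -> ~ of_type type_4E M,
      of_type type_4Dp M -> ~ of_type type_4G M &
      of_type type_4E M -> ~ of_type type_4G M].
Proof.
have Dp0 : exists v, type_4Dp i0 v = v.
  by exists v1; rewrite /type_4Dp /mk_type (tnth_nth 1%g) /= tpermD.
have E2 : exists v, type_4E i2 v = v.
  by exists v1; rewrite /type_4E /mk_type (tnth_nth 1%g) /= tpermD.
have E0 : ~ exists v, type_4E i0 v = v.
  by case=> v; rewrite /type_4E /mk_type (tnth_nth 1%g) /= permM !permE;
    elim/ord4P: v.
have G0 : ~ exists v, type_4G i0 v = v by exact: E0.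
have G2 : ~ exists v, type_4G i2 v = v.
  by case=> v; rewrite /type_4G /mk_type (tnth_nth 1%g) /= permM !permE;
    elim/ord4P: v.
split; [exact: of_type_neq Dp0 E0 | exact: of_type_neq Dp0 G0 |
  exact: of_type_neq E2 G2].
Qed.

(** * Comparing a map with its truncation *)

Theorem proposition5 (M : surface_map)
    (hM : k_orbit_map 4 M) (hTr : k_orbit_map 4 (truncation M)) :
  exactly_one
    (of_type type_4Dp M /\ of_type type_4Dp (truncation M))
    (of_type type_4E M /\ of_type type_4D (truncation M))
    (of_type type_4G M /\ of_type type_4Gd (truncation M)).
Proof.
suff some : [\/ of_type type_4Dp M /\ of_type type_4Dp (truncation M),
    of_type type_4E M /\ of_type type_4D (truncation M)
  | of_type type_4G M /\ of_type type_4Gd (truncation M)].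
  have [DpE DpG EG] := types_4Dp_4E_4G_exclusive M.
  case: some => -[typeM typeTr]; [apply: Or31 | apply: Or32 | apply: Or33];
    split=> // -[typeM' _].
  - exact: DpE.
  - exact: DpG.
  - exact: DpE typeM' typeM.
  - exact: EG.
  - exact: DpG typeM' typeM.
  - exact: EG typeM' typeM.
have [g g_lab] := orbit_labelling_exists hTr.
have [r gr] := orbit_action_exists g_lab.
pose h (x : flag M) := g (x, i0).
have h_lab : orbit_labelling h.
  apply: (orbit_labelling_onto hM) => x y.
  by rewrite -flag_orbit_truncation; apply: g_lab.2.
have [s hs] := orbit_action_exists h_lab.
have h_surj := h_lab.1; have g_surj := g_lab.1.
have rK i : involutive (r i).
  by move=> v; have [p <-] := g_surj v; rewrite -!gr adjK.
(* The vertex-face flags meet every orbit of the truncation, so the action of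
   the adjacencies of the truncation is computed on them. *)
have s1 v : s i1 v = r i0 v.
  by have [x <-] := h_surj v; rewrite -hs /h -gr.
have s2 v : s i2 v = r i1 v.
  by have [x <-] := h_surj v; rewrite -hs /h -gr.
have s0 v : s i0 v = r i2 (r i1 (r i0 (r i1 (r i2 v)))).
  by have [x <-] := h_surj v; rewrite -hs /h -!gr.
have r02 v : r i2 (r i0 v) = r i0 (r i2 v).
  by have [p <-] := g_surj v; rewrite -!gr adj02C.
(* Vertices of the truncation have degree three: [r_1 r_2] has order three. *)
have braid v : r i1 (r i2 (r i1 v)) = r i2 (r i1 (r i2 v)).
  by have [x <-] := h_surj v; rewrite /h -!gr.
have trans (P : pred 'I_4) : (exists z, P z) ->
    (forall z, P z -> [/\ P (r i0 z), P (r i1 z) & P (r i2 z)]) ->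
  forall z, P z.
  move=> [v Pv] Pr w; have [p gp] := g_surj v; have [q <-] := g_surj w.
  have [word ->] := adj_trans p q.
  elim: word p v gp Pv => [|i word IH] p v gp Pv.
    by rewrite /= gp.
  apply: (IH _ (r i v)); first by rewrite gr gp.
  by case: (Pr v Pv); elim/ord3P: i.
have [[bc [z zu]] | [u1 [u2 [u3 [u4 [u_uniq]]]]]] :=
  braid_types (rK i0) (rK i1) (rK i2) r02 braid trans.
  have r01 v : r i1 (r i0 v) = r i0 (r i1 v) by rewrite !bc r02.
  have s00 v : s i0 v = r i0 v by rewrite s0 -!bc !rK.
  apply: Or33; split.
    apply: (of_type_labelling h_lab hs); apply: (type_iso4 zu);
      rewrite ?permM !permE //= !(tnth_nth z) /=;
      by split; rewrite ?s00 ?s1 ?s2 ?r01 ?rK.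
  apply: (of_type_labelling g_lab gr); apply: (type_iso4 zu);
    rewrite ?permM !permE //= !(tnth_nth z) /=;
    by split; rewrite -?bc ?r01 ?rK.
move=> [b1 b2 b3 b4] [c1 c2 c3 c4] [[a1 a2 a3 a4]|[a1 a2 a3 a4]];
  pose actE := (b1, b2, b3, b4, c1, c2, c3, c4, a1, a2, a3, a4).
  apply: Or31; split.
    (* Conjugation makes [s i0] exchange 1 and 4, so the path starts at 2. *)
    have v_uniq : uniq [:: u2; u3; u4; u1] by rewrite -(rot_uniq 1) in u_uniq.
    apply: (of_type_labelling h_lab hs); apply: (type_iso4 v_uniq);
      rewrite ?permM !permE //= !(tnth_nth u1) /=;
      by split; rewrite ?s0 ?s1 ?s2 !actE.
  apply: (of_type_labelling g_lab gr); apply: (type_iso4 u_uniq);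
    rewrite ?permM !permE //= !(tnth_nth u1) /=;
    by split; rewrite !actE.
apply: Or32; split.
  apply: (of_type_labelling h_lab hs); apply: (type_iso4 u_uniq);
    rewrite ?permM !permE //= !(tnth_nth u1) /=;
    by split; rewrite ?s0 ?s1 ?s2 !actE.
apply: (of_type_labelling g_lab gr); apply: (type_iso4 u_uniq);
  rewrite ?permM !permE //= !(tnth_nth u1) /=;
  by split; rewrite !actE.
Qed.
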